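(* Let $a,b:[0,\infty)\to\mathbb{R}$ be Lebesgue measurable and essentially bounded, let $f$ be Lebesgue measurable and locally essentially bounded, and put $$\alpha=\liminf_{t\to\infty}a(t),\qquad \beta=\liminf_{t\to\infty}b(t),\qquad B=\limsup_{t\to\infty}b(t).$$ Suppose $0<\beta\le B<\frac12\alpha^2$. Then the equation $\ddot x(t)+a(t)\dot x(t)+b(t)x(t)=f(t)$ is exponentially stable.
   Context: The fundamental function $X(t,s)$ of the equation is defined as follows: for each fixed $s\ge 0$, $X(\cdot,s)$ is the solution of the homogeneous equation $\ddot x(t)+a(t)\dot x(t)+b(t)x(t)=0$ for $t\ge s$ with $x(s)=0$, $\dot x(s)=1$. The equation is called (uniformly) exponentially stable if its fundamental function has an exponential estimate, i.e. there exist $K>0$, $\lambda>0$ such that $|X(t,s)|\le K e^{-\lambda(t-s)}$ for all $t\ge s\ge 0$. (This property does not depend on $f$.)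
   Formalization: The formal theorem adds the hypothesis α > 0; without it the claim is false, e.g. a = -3, b = 1 gives 0 < β = B = 1 < α²/2 = 4.5, but x'' - 3x' + x = 0 has an exponentially growing fundamental function. *)

(* Defs.v *)
(* World: MathComp / MathComp-Analysis. *)
From HB Require Import structures.
From mathcomp Require Export all_boot all_order all_algebra.
From mathcomp Require Export all_classical all_reals all_analysis measurable_realfun.

Set Implicit Arguments.
Unset Strict Implicit.
Unset Printing Implicit Defensive.

Import Order.TTheory GRing.Theory Num.Theory.
Import numFieldNormedType.Exports.

Local Open Scope classical_set_scope.
Local Open Scope ring_scope.

(* Functions on [0, oo[ are total functions R -> R of which only the values on
   [0, oo[ are constrained or used. *)

Section lebesgue_classes.
Context {R : realType}.
Implicit Types (D : set R) (g : R -> R).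

(* The canonical sigma-algebra on R is the Borel one; Lebesgue measurability
   refers to its completion (the Caratheodory sigma-algebra, by
   [completed_caratheodory_measurable]). *)
Definition Lebesgue_measurable_fun D g : Prop :=
  @measurable_fun _ _
    (g_sigma_algebraType (completed_algebra_gen (@lebesgue_measure R)))
    (measurableTypeR R) D g.

Definition ess_bounded_on D g : Prop :=
  exists M : R, {ae @lebesgue_measure R, forall t, D t -> `|g t| <= M}.

Definition locally_ess_bounded g : Prop :=
  forall T : R, 0 <= T -> ess_bounded_on `[0, T] g.

Definition liminf_pinfty g : \bar R := limf_einf (EFin \o g) (pinfty_nbhs R).

Definition limsup_pinfty g : \bar R := limf_esup (EFin \o g) (pinfty_nbhs R).

End lebesgue_classes.

Section equation.
Context {R : realType}.
Implicit Types (a b x v g : R -> R) (X : R -> R -> R).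

Definition abs_continuous_on (c d : R) g : Prop :=
  forall e : R, 0 < e -> exists2 delta : R, 0 < delta &
    forall (n : nat) (p q : 'I_n -> R),
      (forall i, [/\ c <= p i, p i <= q i & q i <= d]) ->
      trivIset setT (fun i => `]p i, q i[%classic) ->
      \sum_(i < n) (q i - p i) < delta ->
      \sum_(i < n) `|g (q i) - g (p i)| < e.

(* The difference quotient only sees points of [s, oo[, so the derivative is
   one-sided at t = s and two-sided at t > s. *)
Definition has_derivative_from (s : R) x v : Prop :=
  forall t, s <= t ->
    (x u - x t) / (u - t) @[u --> within [set u | s <= u] t^'] --> v t.

(* Solution in the Caratheodory sense, as the coefficients are only measurable:
   the derivative v of x is locally absolutely continuous on [s, oo[ and the
   equation holds almost everywhere. *)
Definition homogeneous_solution a b (s x0 v0 : R) x : Prop :=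
  exists v : R -> R,
    [/\ has_derivative_from s x v,
        forall T, s <= T -> abs_continuous_on s T v,
        {ae @lebesgue_measure R, forall t, s <= t ->
           derivable v t 1 /\ derive1 v t + a t * v t + b t * x t = 0},
        x s = x0 &
        v s = v0].

(* X t s is the value at time t of the solution started at time s. *)
Definition fundamental_function a b X : Prop :=
  forall s, 0 <= s -> homogeneous_solution a b s 0 1 (fun t => X t s).

(* Exponential stability of x'' + a x' + b x = f, whatever the forcing term f.
   For locally integrable a and b the fundamental function exists and its values
   at t >= s >= 0 are unique, so quantifying over X designates that function. *)
Definition exponentially_stable a b : Prop :=
  forall X, fundamental_function a b X ->
    exists K lambda : R, [/\ 0 < K, 0 < lambda &
      forall t s, 0 <= s -> s <= t ->
        `|X t s| <= K * expR (- lambda * (t - s))].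

End equation.

(* Main.v *)
Require Import Defs.
From mathcomp Require Import all_boot all_order all_algebra.
From mathcomp Require Import all_classical all_reals all_analysis.
From mathcomp Require Import ring lra.

Set Implicit Arguments.
Unset Strict Implicit.
Unset Printing Implicit Defensive.

Import Order.TTheory GRing.Theory Num.Theory.
Import numFieldNormedType.Exports.

Local Open Scope classical_set_scope.
Local Open Scope ring_scope.

(* For large t we have a >= 2r and 0 < b0 <= b <= b1 < 2r^2.  In the variables x
   and y = x' + r x the equation reads x' = -r x + y and
   y' = -(a - r) y + (r (a - r) - b) x, a system whose off-diagonal entries are
   dominated by the diagonal ones: for suitable m < r and l > 0,
   exp(l t) max(|x|, |y| / m) is nonincreasing.  On the initial part of the
   half-line the same computation with l negative gives a bound uniform in the
   starting time.  Since the coefficients are only measurable, monotonicity is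
   deduced from the sign of the slopes almost everywhere, by absolute
   continuity. *)

Lemma interval_induction (R : realType) (c d : R) (P : R -> Prop) :
  c <= d -> P c ->
  (forall t, c <= t <= d -> exists2 delta : R, 0 < delta &
    forall p q, c <= p -> p <= t -> t <= q -> q <= d -> q - p < delta ->
      P p -> P q) ->
  P d.
Proof.
move=> cd Pc step; pose S := [set x | c <= x <= d /\ P x].
have Sc : S c by split; rewrite ?lexx.
have Sd x : S x -> x <= d by case=> /andP[].
have hS : has_sup S by split; [exists c | exists d => x /Sd].
have cs : c <= sup S := sup_upper_bound hS Sc.
have sd : sup S <= d by apply: ge_sup; [exists c | move=> x /Sd].
have [|delta delta0 loc] := step (sup S); first by rewrite cs sd.
have [|p [/andP[cp pd] Pp] ltp] := @sup_adherent _ S (delta / 2) _ hS.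
  by rewrite divr_gt0.
have ps : p <= sup S by apply: sup_upper_bound => //; split; rewrite ?cp.
set q := Num.min d (sup S + delta / 2).
have qd : q <= d by rewrite ge_min lexx.
have sq : sup S <= q by rewrite le_min sd lerDl; lra.
have qle : q <= sup S + delta / 2 by rewrite ge_min lexx orbT.
have Pq : P q by apply: (loc p) => //; lra.
have qs : q <= sup S.
  by apply: sup_upper_bound => //; split=> //; rewrite qd andbT; lra.
suff -> : d = q by [].
rewrite /q; apply/esym/min_idPl; case: (leP d (sup S + delta / 2)) => // lt.
by move: qs; rewrite /q (min_r (ltW lt)); lra.
Qed.

Section nonincreasing.
Context {R : realType}.
Implicit Types (g v : R -> R) (c d t eps : R).

(* One inequality for all intervals containing t, with no difference quotient
   at t itself: this is the form that can be summed along a chain of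
   intervals. *)
Definition straddle_nonincreasing c d g t : Prop :=
  forall eps, 0 < eps -> exists2 delta : R, 0 < delta &
    forall p q, c <= p -> p <= t -> t <= q -> q <= d -> q - p < delta ->
      g q - g p <= eps * (q - p).

Lemma everywhere_nonincreasing c d g : c <= d ->
  (forall t, c <= t <= d -> straddle_nonincreasing c d g t) -> g d <= g c.
Proof.
move=> cd sg; apply/ler_addgt0Pr => e e0.
have D0 : 0 < d - c + 1 by lra.
have: g d - g c <= e / (d - c + 1) * (d - c).
  apply: (@interval_induction R c d
    (fun t => g t - g c <= e / (d - c + 1) * (t - c))) => //.
    by rewrite !subrr mulr0.
  move=> t tcd; have [|delta d0 loc] := sg t tcd (e / (d - c + 1)).
    exact: divr_gt0.
  exists delta => // p q cp pt tq qd qp IH.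
  have := loc p q cp pt tq qd qp; nra.
have: e / (d - c + 1) * (d - c) <= e.
  by rewrite mulrAC ler_pdivrMr //; nra.
lra.
Qed.

(* The increments of g over a set U are kept, elsewhere g grows with slope at
   most eps. *)
Definition chain (U : set R) g eps c t : Prop :=
  exists (n : nat) (p q : nat -> R),
    [/\ forall i, (i < n)%N -> [/\ c <= p i, p i <= q i & q i <= t],
        forall i j, (i < j < n)%N -> q i <= p j,
        forall i, (i < n)%N -> `]p i, q i[ `<=` U &
        g t - g c <= eps * (t - c) + \sum_(i < n) (g (q i) - g (p i))].

Lemma chain_slope U g eps c p q : p <= q -> chain U g eps c p ->
  g q - g p <= eps * (q - p) -> chain U g eps c q.
Proof.
move=> pq [n [P [Q [PQ dis sub le]]]] step; exists n, P, Q; split=> //.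
  by move=> i /PQ[? ? ?]; split=> //; lra.
lra.
Qed.

Lemma chain_open U g eps c p q : 0 < eps -> c <= p -> p <= q ->
  `]p, q[ `<=` U -> chain U g eps c p -> chain U g eps c q.
Proof.
move=> eps0 cp pq sU [n [P [Q [PQ dis sub le]]]].
exists n.+1, (fun i => if i == n then p else P i),
  (fun i => if i == n then q else Q i); split.
- move=> i; rewrite ltnS leq_eqVlt; case: eqVneq => //= _ /PQ[? ? ?].
  by split=> //; lra.
- move=> i j /andP[ij]; rewrite ltnS => jn.
  have ni : (i < n)%N := leq_trans ij jn.
  rewrite (ltn_eqF ni); move: jn; rewrite leq_eqVlt.
  case: eqVneq => [->|_] /= jn; first by case: (PQ i ni) => ? ? ?; lra.
  by apply: dis; rewrite ij.
- by move=> i; rewrite ltnS leq_eqVlt; case: eqVneq => //= _; exact: sub.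
rewrite big_ord_recr /= eqxx.
under eq_bigr => i _ do rewrite (ltn_eqF (ltn_ord i)).
have : 0 <= eps * (q - p) by apply: mulr_ge0; lra.
lra.
Qed.

Lemma disjoint_intervals_length (U : set R) (e : R) n (p q : 'I_n -> R) :
  measurable U -> (lebesgue_measure U < e%:E)%E ->
  (forall i, p i <= q i) -> (forall i, `]p i, q i[ `<=` U) ->
  trivIset setT (fun i => `]p i, q i[%classic) ->
  \sum_(i < n) (q i - p i) < e.
Proof.
move=> mU Ue pq sU dis; rewrite -lte_fin; apply: le_lt_trans Ue.
have -> : (\sum_(i < n) (q i - p i))%:E =
    (\sum_(i < n) lebesgue_measure `]p i, q i[%classic)%E.
  rewrite -sumEFin; apply: eq_bigr => i _.
  rewrite lebesgue_measure_itv /= lte_fin EFinB.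
  case: ltP => // qp; have -> : p i = q i by apply/eqP; rewrite eq_le pq.
  by rewrite subee.
rewrite -measure_semi_additive_ord //; last exact: bigsetU_measurable.
apply: le_measure; rewrite ?inE //; first exact: bigsetU_measurable.
by apply: (big_ind (fun A => A `<=` U)) => // A B AU BU; rewrite subUset.
Qed.

Lemma null_set_open_cover (N : set R) (e : R) :
  measurable N -> lebesgue_measure N = 0%E -> 0 < e ->
  exists U : set R, [/\ open U, N `<=` U & (lebesgue_measure U < e%:E)%E].
Proof.
move=> mN N0 e0; have Noo : (lebesgue_measure N < +oo)%E by rewrite N0.
have [U [oU NU UNe]] := lebesgue_regularity_outer mN Noo e0.
exists U; split=> //; rewrite -(setDUK NU) setUC.
have mU : measurable U := open_measurable oU.
have le : (lebesgue_measure ((U `\` N) `|` N) <=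
    lebesgue_measure (U `\` N) + lebesgue_measure N)%E.
  by apply: measureU2 => //; exact: measurableD.
by apply: le_lt_trans le _; rewrite N0 adde0.
Qed.

(* The exceptional null set is covered by an open set of small measure, and
   interval induction gives a chain on which the growth of g is controlled by
   the slope outside the open set and by absolute continuity inside. *)
Lemma ae_nonincreasing c d v g (C : R) : c <= d -> 0 < C ->
  abs_continuous_on c d v ->
  (forall p q, c <= p -> p <= q -> q <= d ->
    g q - g p <= C * (`|v q - v p| + (q - p))) ->
  {ae lebesgue_measure, forall t, c <= t <= d ->
    straddle_nonincreasing c d g t} ->
  g d <= g c.
Proof.
move=> cd C0 acv gv [N [mN N0 sN]]; apply/ler_addgt0Pr => e e0.
have D0 : 0 < d - c + 1 by lra.
have e1 : 0 < e / (3 * C) by rewrite divr_gt0 ?mulr_gt0.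
have [delta delta0 small] := acv _ e1.
set m := Num.min delta (e / (3 * C)).
have m0 : 0 < m by rewrite lt_min delta0.
have [U [oU NU Um]] := null_set_open_cover mN N0 m0.
have mU : measurable U := open_measurable oU.
set eps := e / (3 * (d - c + 1)).
have eps0 : 0 < eps by rewrite divr_gt0 ?mulr_gt0.
have : chain U g eps c d.
  apply: interval_induction cd _ _.
    exists 0%N, (fun=> 0), (fun=> 0); split=> //.
    by rewrite big_ord0 !subrr mulr0 addr0.
  move=> t tcd; have [Ut|nUt] := pselect (U t).
    have /nbhs_ballP[r /= r0 rU] := open_nbhs_nbhs (conj oU Ut).
    exists r => // p q cp pt tq qd qp; apply: chain_open => //.
      lra.
    move=> x /=; rewrite in_itv /= => /andP[px xq]; apply: rU.
    by rewrite /ball /= ltr_distl; lra.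
  have : straddle_nonincreasing c d g t.
    apply: contrapT => nst; apply: nUt; apply: NU; apply: sN => /= tt.
    by apply: nst; apply: tt.
  move=> /(_ _ eps0)[r r0 loc]; exists r => // p q cp pt tq qd qp.
  by move=> /chain_slope; apply; [lra | exact: loc].
move=> [n [p [q [pq dis sU le]]]].
have dis' : trivIset setT (fun i : 'I_n => `]p i, q i[%classic).
  apply/trivIsetP => i j _ _ ij; apply/seteqP; split=> // x [] /=.
  rewrite !in_itv /= => /andP[pix xqi] /andP[pjx xqj].
  move: ij; rewrite neq_ltn => /orP[] ij.
    by have := dis i j; rewrite ij ltn_ord => /(_ isT); lra.
  by have := dis j i; rewrite ij ltn_ord => /(_ isT); lra.
have len : \sum_(i < n) (q i - p i) < m.
  apply: (disjoint_intervals_length mU Um) => // i; last exact: sU.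
  by have [] := pq _ (ltn_ord i).
have var : \sum_(i < n) `|v (q i) - v (p i)| < e / (3 * C).
  apply: (small _ (fun i => p i) (fun i => q i)) => //.
    by move=> i; have [] := pq _ (ltn_ord i).
  by rewrite (lt_le_trans len) // ge_min lexx.
have : \sum_(i < n) (g (q i) - g (p i)) <=
    C * (\sum_(i < n) `|v (q i) - v (p i)| + \sum_(i < n) (q i - p i)).
  rewrite -big_split /= mulr_sumr; apply: ler_sum => i _.
  by have [? ? ?] := pq _ (ltn_ord i); exact: gv.
have m1 : m <= e / (3 * C) by rewrite ge_min lexx orbT.
have E1 : C * (e / (3 * C)) = e / 3 by field; rewrite gt_eqF.
have E2 : eps * (d - c) <= e / 3.
  rewrite /eps -subr_ge0.
  have -> : e / 3 - e / (3 * (d - c + 1)) * (d - c) = e / 3 / (d - c + 1).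
    by field; rewrite gt_eqF.
  by rewrite !divr_ge0 ?ltW.
nra.
Qed.

End nonincreasing.

Section slopes.
Context {R : realType}.
Implicit Types (f g x v : R -> R) (s c d t D : R).

Definition slope_from s f t D : Prop :=
  (f u - f t) / (u - t) @[u --> within [set u | s <= u] t^'] --> D.

Lemma slope_from_remainder s f t D eps : slope_from s f t D -> 0 < eps ->
  exists2 delta : R, 0 < delta & forall u, s <= u -> `|u - t| < delta ->
    `|f u - f t - D * (u - t)| <= eps * `|u - t|.
Proof.
move=> sl eps0; have /cvgrPdist_le/(_ _ eps0) := sl.
move=> /nbhs_ballP[r /= r0 rP]; exists r => // u su ur.
have [->|ut] := eqVneq u t; first by rewrite !subrr mulr0 subrr !normr0 mulr0.
have /(_ _ _ su) := rP u; rewrite /ball /= distrC => /(_ ur ut) le.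
have ut0 : u - t != 0 by rewrite subr_eq0.
have -> : f u - f t - D * (u - t) = - (D - (f u - f t) / (u - t)) * (u - t).
  by field.
by rewrite normrM normrN ler_wpM2r.
Qed.

Lemma derivable_slope_from s f t :
  derivable f t 1 -> slope_from s f t (derive1 f t).
Proof.
move=> df; apply/cvgrPdist_le => e e0.
have /cvgrPdist_le/(_ _ e0)/nbhs_ballP[r /= r0 rP] := df.
apply/nbhs_ballP; exists r => // u; rewrite /ball /= => ur ut su.
have ut0 : u - t != 0 by rewrite subr_eq0.
have := rP (u - t); rewrite /ball /= sub0r normrN -opprB normrN opprB.
rewrite distrC => /(_ _ ut0); rewrite distrC => /(_ ur).
by rewrite derive1E /= scaler1 subrK /derive /= mulrC.
Qed.

Lemma slope_from_linear s f g t Df Dg (k l : R) :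
  slope_from s f t Df -> slope_from s g t Dg ->
  slope_from s (fun u => k * f u + l * g u) t (k * Df + l * Dg).
Proof.
move=> sf sg; rewrite /slope_from.
rewrite (_ : (fun u => _) = (fun u => k * ((f u - f t) / (u - t)) +
   l * ((g u - g t) / (u - t)))); last by apply/funext => u; ring.
by apply: cvgD; apply: cvgM => //; exact: cvg_cst.
Qed.

Lemma slope_from_mul s f g t Df Dg : {for t, continuous f} ->
  slope_from s f t Df -> slope_from s g t Dg ->
  slope_from s (fun u => f u * g u) t (f t * Dg + Df * g t).
Proof.
move=> cf sf sg; rewrite /slope_from.
rewrite (_ : (fun u => _) = (fun u => f u * ((g u - g t) / (u - t)) +
   (f u - f t) / (u - t) * g t)); last by apply/funext => u; ring.
apply: cvgD; apply: cvgM => //; last exact: cvg_cst.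
by apply: cvg_within_filter; apply: cvg_within_filter.
Qed.

Lemma straddle_max s c d t (I : finType) (h : I -> R -> R) g (D : I -> R) :
  s <= c ->
  (forall i, slope_from s (h i) t (D i)) ->
  (forall i u, h i u <= g u) -> (forall u, exists i, g u = h i u) ->
  (forall i, h i t = g t -> D i <= 0) ->
  straddle_nonincreasing c d g t.
Proof.
move=> sc sl hg gh D0 eps eps0.
pose Q i r := forall p q, c <= p -> p <= t -> t <= q -> q <= d -> q - p < r ->
  h i q - g p <= eps * (q - p).
suff : \forall r \near 0^'+, forall i, Q i r.
  move=> /(filterI (nbhs_right_gt 0))/filter_ex[r [r0 Qr]]; exists r => //.
  by move=> p q cp pt tq qd qp; have [i ->] := gh q; exact: Qr.
apply: filter_forall => i.
suff [delta delta0 Qd] : exists2 delta : R, 0 < delta & Q i delta.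
  near=> r => p q cp pt tq qd qp; apply: Qd => //; apply: lt_trans qp _.
  by near: r; exact: nbhs_right_lt.
have := hg i t; rewrite le_eqVlt => /orP[/eqP hgt|lt].
  have [delta delta0 rem] := slope_from_remainder (sl i) eps0.
  exists delta => // p q cp pt tq qd qp.
  have := rem p; rewrite ler0_norm ?subr_le0 // => /(_ _ _)/ler_normlP[||+ _].
  - lra.
  - lra.
  have := rem q; rewrite ger0_norm ?subr_ge0 // => /(_ _ _)/ler_normlP[||_].
  - lra.
  - lra.
  have : D i * (q - p) <= 0 by apply: mulr_le0_ge0; [exact: D0 | lra].
  have := hg i p. lra.
have [j gj] := gh t; rewrite gj in lt.
have [di di0 remi] := slope_from_remainder (sl i) ltr01.
have [dj dj0 remj] := slope_from_remainder (sl j) ltr01.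
set M := `|D i| + `|D j| + 1.
have M0 : 0 < M by rewrite ltr_wpDl // addr_ge0.
exists (Num.min di (Num.min dj ((h j t - h i t) / M))).
  by rewrite !lt_min di0 dj0 divr_gt0 // subr_gt0.
move=> p q cp pt tq qd; rewrite !lt_min ltr_pdivlMr // => /and3P[qpi qpj gap].
have := remj p; rewrite ler0_norm ?subr_le0 // => /(_ _ _)/ler_normlP[||+ _].
- lra.
- lra.
have := remi q; rewrite ger0_norm ?subr_ge0 // => /(_ _ _)/ler_normlP[||_].
- lra.
- lra.
have := hg j p.
have : D i * (q - t) <= `|D i| * (q - t).
  by apply: ler_wpM2r; [lra | exact: ler_norm].
have : - D j * (p - t) <= `|D j| * (t - p).
  by rewrite mulNr -mulrN opprB; apply: ler_wpM2r; [lra | exact: ler_norm].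
have : 0 <= `|D i| * (t - p) by apply: mulr_ge0; [|lra].
have : 0 <= `|D j| * (q - t) by apply: mulr_ge0; [|lra].
have : 0 <= eps * (q - p) by apply: mulr_ge0; lra.
rewrite /M in gap. lra.
Unshelve. all: by end_near. Qed.

End slopes.

Section solutions.
Context {R : realType}.
Implicit Types (a b f x v : R -> R) (s c d t rho m l V : R).

Lemma abs_continuous_on_sub c d c' d' v : c <= c' -> d' <= d ->
  abs_continuous_on c d v -> abs_continuous_on c' d' v.
Proof.
move=> cc dd ac e /ac[delta delta0 acd]; exists delta => // n p q pq.
by apply: acd => i; have [? ? ?] := pq i; split=> //; lra.
Qed.

Lemma abs_continuous_bounded c d v : c <= d -> abs_continuous_on c d v ->
  exists2 V, 0 < V & forall u, c <= u <= d -> `|v u| <= V.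
Proof.
move=> cd /(_ 1 ltr01)[delta delta0 small].
apply: (@interval_induction R c d
  (fun t => exists2 V, 0 < V & forall u, c <= u <= t -> `|v u| <= V)) => //.
  exists (`|v c| + 1); first by rewrite ltr_wpDl.
  by move=> u; rewrite -eq_le => /eqP <-; lra.
move=> t tcd; exists delta => // p q cp pt tq qd qp [V V0 vV].
exists (V + 1); first lra.
move=> u /andP[cu uq]; have [up|pu] := leP u p.
  by rewrite (le_trans (vV u _)) ?cu //; lra.
have lt1 : `|v u - v p| < 1.
  have := small 1%N (fun=> p) (fun=> u); rewrite !big_ord1; apply.
  - by move=> i; split; lra.
  - by apply/trivIsetP => i j _ _; rewrite !ord1 eqxx.
  - lra.
have vp : `|v p| <= V by apply: vV; rewrite cp lexx.
have := ler_normD (v p) (v u - v p); rewrite addrC subrK; lra.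
Qed.

Lemma slope_from_growth s c d f (D : R -> R) V p q : s <= c ->
  (forall t, c <= t <= d -> slope_from s f t (D t)) ->
  (forall t, c <= t <= d -> D t <= V) ->
  c <= p -> p <= q -> q <= d -> f q - f p <= V * (q - p).
Proof.
move=> sc sl DV cp pq qd.
suff : f q - V * q <= f p - V * p by lra.
apply: (everywhere_nonincreasing (g := fun u => f u - V * u)) => // t tpq e e0.
have tcd : c <= t <= d by lra.
have [delta delta0 rem] := slope_from_remainder (sl t tcd) e0.
exists delta => // p' q' pp' p't tq' qq' qp'.
have := rem p'; rewrite ler0_norm ?subr_le0 // => /(_ _ _)/ler_normlP[||+ _].
- lra.
- lra.
have := rem q'; rewrite ger0_norm ?subr_ge0 // => /(_ _ _)/ler_normlP[||_].
- lra.
- lra.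
have : D t * (q' - p') <= V * (q' - p').
  by apply: ler_wpM2r; [lra | exact: DV].
lra.
Qed.

Lemma slope_from_lipschitz s c d f (D : R -> R) V p q : s <= c ->
  (forall t, c <= t <= d -> slope_from s f t (D t)) ->
  (forall t, c <= t <= d -> `|D t| <= V) ->
  c <= p -> p <= q -> q <= d -> `|f q - f p| <= V * (q - p).
Proof.
move=> sc sl DV cp pq qd; apply/ler_normlP; split; last first.
  apply: (slope_from_growth sc sl _ cp pq qd) => t tcd.
  exact: le_trans (ler_norm _) (DV _ tcd).
have sl' t : c <= t <= d ->
    slope_from s (fun u => -1 * f u + 0 * f u) t (-1 * D t + 0 * D t).
  by move=> tcd; apply: slope_from_linear; exact: sl.
suff : -1 * f q + 0 * f q - (-1 * f p + 0 * f p) <= V * (q - p) by lra.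
apply: (slope_from_growth sc sl' _ cp pq qd) => t tcd.
have := ler_norm (- D t); rewrite normrN; have := DV t tcd; lra.
Qed.

Lemma is_derive_expR_scale l t :
  is_derive t 1 (fun u => expR (l * u)) (l * expR (l * t)).
Proof.
have dl : is_derive t 1 (fun u : R => l * u) l.
  by have := is_deriveZ l (is_derive_id t (1 : R)); rewrite /GRing.scale /= mulr1.
by rewrite mulrC; exact: (is_derive1_comp (is_derive_expR _) dl).
Qed.

Lemma continuous_expR_scale l t : {for t, continuous (fun u => expR (l * u))}.
Proof.
apply: differentiable_continuous; apply/derivable1_diffP.
by have [] := is_derive_expR_scale l t.
Qed.

Lemma slope_from_expR_scale s l t :
  slope_from s (fun u => expR (l * u)) t (l * expR (l * t)).
Proof.
have [dE <-] := is_derive_expR_scale l t.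
by rewrite -derive1E; exact: derivable_slope_from.
Qed.

Lemma expR_scale_bounded l c d :
  exists2 M, 0 < M & forall u, c <= u <= d -> expR (l * u) <= M.
Proof.
exists (expR (`|l| * (`|c| + `|d|))); first exact: expR_gt0.
move=> u /andP[cu ud]; rewrite ler_expR (le_trans (ler_norm _)) // normrM.
apply: ler_wpM2l => //; apply/ler_normlP.
have := ler_norm (- c); have := ler_norm d; rewrite normrN.
have : 0 <= `|c| by []. have : 0 <= `|d| by [].
by split; lra.
Qed.

Lemma weighted_combination_increment l c d s x v (k1 k2 : R) :
  s <= c -> c <= d ->
  (forall t, c <= t <= d -> slope_from s x t (v t)) ->
  abs_continuous_on c d v ->
  exists2 C : R, 0 < C & forall p q, c <= p -> p <= q -> q <= d ->
    expR (l * q) * (k1 * x q + k2 * v q) -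
    expR (l * p) * (k1 * x p + k2 * v p) <= C * (`|v q - v p| + (q - p)).
Proof.
move=> sc cd sl acv.
have [V V0 vV] := abs_continuous_bounded cd acv.
have [M M0 eM] := expR_scale_bounded l c d.
have xlip := slope_from_lipschitz sc sl vV.
have elip : forall p q, c <= p -> p <= q -> q <= d ->
    `|expR (l * q) - expR (l * p)| <= `|l| * M * (q - p).
  move=> p q; apply: (slope_from_lipschitz sc (f := fun t => expR (l * t))
    (D := fun t => l * expR (l * t))) => t tcd.
    exact: slope_from_expR_scale.
  by rewrite normrM ler_wpM2l // ger0_norm ?expR_ge0 // eM.
set X := `|x c| + V * (d - c).
have xX u : c <= u -> u <= d -> `|x u| <= X.
  move=> cu ud; have := xlip c u (lexx _) cu ud.
  have := ler_normD (x c) (x u - x c); rewrite addrC subrK.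
  have : V * (u - c) <= V * (d - c) by rewrite ler_pM2l //; lra.
  rewrite /X; lra.
set W := `|k1| * X + `|k2| * V.
have X0 : 0 <= X by rewrite addr_ge0 // mulr_ge0 ?subr_ge0 // ltW.
have W0 : 0 <= W by rewrite addr_ge0 // mulr_ge0 // ltW.
exists (M * (`|k1| * V + `|k2|) + `|l| * M * W + 1).
  apply: ltr_wpDl => //.
  by repeat (exact: W0 || apply: addr_ge0 || apply: mulr_ge0);
    first [done | exact: ltW].
move=> p q cp pq qd.
set dv := `|v q - v p|; set h := q - p.
have dv0 : 0 <= dv := normr_ge0 _.
have h0 : 0 <= h by rewrite subr_ge0.
set w := fun u => k1 * x u + k2 * v u.
have dw : `|w q - w p| <= `|k1| * (V * h) + `|k2| * dv.
  have -> : w q - w p = k1 * (x q - x p) + k2 * (v q - v p) by rewrite /w; ring.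
  rewrite (le_trans (ler_normD _ _)) // !normrM lerD2r ler_wpM2l //.
  exact: xlip.
have wW : `|w p| <= W.
  rewrite (le_trans (ler_normD _ _)) // !normrM lerD // ler_wpM2l //.
    by apply: xX; lra.
  by apply: vV; lra.
rewrite -/(w q) -/(w p).
have -> : expR (l * q) * w q - expR (l * p) * w p =
    expR (l * q) * (w q - w p) + (expR (l * q) - expR (l * p)) * w p by ring.
apply: le_trans (ler_norm _) _; apply: le_trans (ler_normD _ _) _.
rewrite !normrM.
have -> : (M * (`|k1| * V + `|k2|) + `|l| * M * W + 1) * (dv + h) =
  M * (`|k1| * (V * h) + `|k2| * dv) + `|l| * M * h * W +
  (M * (`|k1| * V) * dv + M * `|k2| * h + `|l| * M * W * dv + (dv + h)) by ring.
rewrite -[leLHS]addr0; apply: lerD; last first.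
  by repeat (exact: W0 || exact: h0 || exact: dv0 ||
     apply: addr_ge0 || apply: mulr_ge0);
    first [done | exact: ltW].
apply: lerD; apply: ler_pM => //; last exact: elip.
by rewrite ger0_norm ?expR_ge0 // eM //; lra.
Qed.

End solutions.

#[local] Instance ae_lebesgue_filter (R : realType) :
  Filter (almost_everywhere (@lebesgue_measure R)).
Proof. exact: (@ae_filter_ringOfSetsType _ _ _ lebesgue_measure). Qed.

Section weighted_norm.
Context {R : realType}.
Implicit Types (a b x v : R -> R) (s c d t rho m l : R).

Definition weighted_norm rho m x v t : R :=
  Num.max `|x t| (`|v t + rho * x t| / m).

Lemma weighted_norm_ge0 rho m x v t : 0 <= weighted_norm rho m x v t.
Proof. by rewrite le_max normr_ge0. Qed.

(* A multiple of the weighted norm is the maximum of four linear forms in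
   (x, v); only the forms that attain the maximum at t matter for its slope
   there. *)
Lemma weighted_norm_nonincreasing a b s c d x v rho m l :
  s <= c -> c <= d -> 0 < m ->
  has_derivative_from s x v -> abs_continuous_on c d v ->
  {ae lebesgue_measure, forall t, s <= t ->
     derivable v t 1 /\ derive1 v t + a t * v t + b t * x t = 0} ->
  l + m <= rho ->
  {ae lebesgue_measure, forall t, c <= t <= d ->
     `|rho * (a t - rho) - b t| <= m * (a t - rho - l)} ->
  expR (l * d) * weighted_norm rho m x v d <=
  expR (l * c) * weighted_norm rho m x v c.
Proof.
move=> sc cd m0 dx acv ode lm cond.
have mn0 : m != 0 by rewrite gt_eqF.
set W := weighted_norm rho m x v.
pose k1 (i : bool * bool) : R := (-1) ^+ i.2 * (if i.1 then rho / m else 1).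
pose k2 (i : bool * bool) : R := (-1) ^+ i.2 * (if i.1 then m^-1 else 0).
pose w i u := k1 i * x u + k2 i * v u.
have wF e u : w (false, e) u = (-1) ^+ e * x u by rewrite /w /k1 /k2 /=; ring.
have wT e u : w (true, e) u = (-1) ^+ e * ((v u + rho * x u) / m).
  by rewrite /w /k1 /k2 /=; ring.
have sgn_le e (z : R) : (-1) ^+ e * z <= `|z|.
  by rewrite (le_trans (ler_norm _)) // normrMsign.
have sgn_ex (z : R) : exists e : bool, `|z| = (-1) ^+ e * z.
  by exists (z < 0); rewrite -normrEsign.
have normy u : `|v u + rho * x u| / m = `|(v u + rho * x u) / m|.
  by rewrite normrM normfV (gtr0_norm m0).
have wW i u : w i u <= W u.
  case: i => -[] e; rewrite ?wF ?wT /W /weighted_norm le_max ?normy.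
    by rewrite sgn_le orbT.
  by rewrite sgn_le.
have Ww u : exists i, W u = w i u.
  rewrite /W /weighted_norm normy.
  have [e1 E1] := sgn_ex (x u); have [e2 E2] := sgn_ex ((v u + rho * x u) / m).
  case: leP => _; [exists (true, e2) | exists (false, e1)].
    by rewrite wT E2.
  by rewrite wF E1.
have E0 u : 0 < expR (l * u) := expR_gt0 _.
pose h i u := expR (l * u) * w i u.
pose g u := expR (l * u) * W u.
have hg i u : h i u <= g u by rewrite ler_pM2l.
have gh u : exists i, g u = h i u.
  by have [i Wi] := Ww u; exists i; rewrite /g Wi.
have dxc t : c <= t <= d -> slope_from s x t (v t).
  by move=> /andP[ct _]; apply: dx; lra.
have [C C0 incr] : exists2 C, 0 < C & forall p q, c <= p -> p <= q -> q <= d ->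
    g q - g p <= C * (`|v q - v p| + (q - p)).
  have inc i := weighted_combination_increment l (k1 i) (k2 i) sc cd dxc acv.
  pose Q i C := forall p q, c <= p -> p <= q -> q <= d ->
    h i q - h i p <= C * (`|v q - v p| + (q - p)).
  have : \forall C \near +oo, forall i, Q i C.
    apply: filter_forall => i; have [Ci Ci0 Qi] := inc i.
    near=> C => p q cp pq qd; apply: le_trans (Qi p q cp pq qd) _.
    apply: ler_wpM2r; first by rewrite addr_ge0 // subr_ge0.
    by near: C; apply: nbhs_pinfty_ge; exact: num_real.
  move=> /(filterI (nbhs_pinfty_gt (num_real 0)))/filter_ex[C [C0 QC]].
  exists C => // p q cp pq qd; have [i ->] := gh q.
  by have := QC i p q cp pq qd; have := hg i p; lra.
apply: (@ae_nonincreasing _ c d v g C) => //.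
move: cond ode; apply: filterS2 => t condt odet tcd.
have ct : s <= t by lra.
have {condt} := condt tcd; have [dv ode] := odet ct.
set kappa := rho * (a t - rho) - b t => condt.
pose D i := expR (l * t) * (k1 i * v t + k2 i * derive1 v t) +
  l * expR (l * t) * w i t.
apply: (@straddle_max _ s c d t _ h g D) => // i.
  apply: slope_from_mul; first exact: continuous_expR_scale.
    exact: slope_from_expR_scale.
  by apply: slope_from_linear; [exact: dx | exact: derivable_slope_from].
move=> /(mulfI (lt0r_neq0 (E0 t))) wiW.
have -> : D i = expR (l * t) *
    (k1 i * v t + k2 i * derive1 v t + l * W t) by rewrite /D wiW; ring.
rewrite pmulr_rle0 //.
have W0 : 0 <= W t := weighted_norm_ge0 _ _ _ _ _.
have v'E : derive1 v t = - a t * v t - b t * x t by lra.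
case: i wiW => -[] e; rewrite ?wF ?wT => wiW; rewrite /k1 /k2 /= v'E.
  have xW : kappa * ((-1) ^+ e * x t) <= `|kappa| * W t.
    rewrite (le_trans (ler_norm _)) // normrM ler_wpM2l //.
    by rewrite normrMsign /W /weighted_norm le_max lexx.
  have -> : (-1) ^+ e * (rho / m) * v t +
      (-1) ^+ e / m * (- a t * v t - b t * x t) + l * W t =
      (kappa * ((-1) ^+ e * x t)) / m - (a t - rho - l) * W t.
    by rewrite -wiW /kappa; field.
  rewrite subr_le0 ler_pdivrMr // (le_trans xW) // mulrAC ler_wpM2r //.
  by rewrite mulrC.
have yW : (-1) ^+ e * ((v t + rho * x t) / m) <= W t.
  by rewrite -wT; exact: wW.
have -> : (-1) ^+ e * 1 * v t + (-1) ^+ e * 0 * (- a t * v t - b t * x t) +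
    l * W t = m * ((-1) ^+ e * ((v t + rho * x t) / m)) + (l - rho) * W t.
  by rewrite -wiW; field.
have : m * ((-1) ^+ e * ((v t + rho * x t) / m)) <= m * W t.
  by rewrite ler_pM2l.
have : (l + m) * W t <= rho * W t by rewrite ler_wpM2r.
lra.
Unshelve. all: by end_near. Qed.

End weighted_norm.

Section limits.
Context {R : realType}.
Implicit Types (g : R -> R) (r : R).

Lemma limsup_pinfty_lt g r : (limsup_pinfty g < r%:E)%E ->
  exists M, forall t, M < t -> g t <= r.
Proof.
move=> /ereal_inf_lt[_ [V [M [_ MV]] <-]] supV; exists M => t Mt.
rewrite -lee_fin ltW //; apply: le_lt_trans supV.
by apply: ereal_sup_ubound; exists t => //; exact: MV.
Qed.

Lemma liminf_pinfty_gt g r : (r%:E < liminf_pinfty g)%E ->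
  exists M, forall t, M < t -> r <= g t.
Proof.
rewrite /liminf_pinfty /limf_einf lteNr -EFinN => gt.
have [M gM] := @limsup_pinfty_lt (\- g) (- r) gt.
by exists M => t /gM; rewrite lerN2.
Qed.

Lemma strict_bounds (alpha beta B : \bar R) :
  (0 < alpha)%E -> (0 < beta)%E -> (beta <= B)%E ->
  (B < (2^-1)%:E * alpha ^+ 2)%E ->
  exists r b0 b1 : R, [/\ 0 < r, 0 < b0, b1 < 2 * r ^+ 2,
    ((2 * r)%:E < alpha)%E & (b0%:E < beta)%E /\ (B < b1%:E)%E].
Proof.
move=> alpha0 beta0 betaB Balpha.
have [b0 b00 b0beta] : exists2 b0 : R, 0 < b0 & (b0%:E < beta)%E.
  case: beta beta0 {betaB} => [z||] //; last by exists 1; rewrite ?ltry.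
  by rewrite lte_fin => z0; exists (z / 2); rewrite ?lte_fin; lra.
have B0 : (0 < B)%E := lt_le_trans beta0 betaB.
case: B B0 Balpha {betaB} => [B| |] //; rewrite ?lte_fin => B0; last first.
  by rewrite ltNge leey.
case: alpha alpha0 => [z| |] //; last first.
  move=> _ _; exists (B + 1), b0, (B + 1).
  have lt : B < B + 1 by lra.
  by split; rewrite ?ltry ?lte_fin //; nra.
rewrite lte_fin => z0; rewrite -EFin_expe -EFinM lte_fin => Bz.
set b1 := (B + 2^-1 * z ^+ 2) / 2.
set delta := (z ^+ 2 - 2 * b1) / (4 * z).
have num0 : 0 < z ^+ 2 - 2 * b1 by rewrite /b1; lra.
have delta0 : 0 < delta by rewrite divr_gt0 // mulr_gt0.
have deltaz : 4 * (delta * z) = z ^+ 2 - 2 * b1.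
  by rewrite /delta; field; rewrite gt_eqF.
have b10 : 0 < b1 by rewrite /b1; nra.
exists ((z - delta) / 2), b0, b1; split=> //; rewrite ?lte_fin.
- have : delta < z by nra.
  lra.
- nra.
- lra.
- by split=> //; rewrite /b1; lra.
Qed.

End limits.

Section decay.
Context {R : realType}.

(* Here p = a - r and c = b; the two bounds on k handle the two signs of
   r p - c, whose extreme values are attained at p = C and at p = r. *)
Lemma damping_condition (r p c b0 b1 C k : R) :
  0 < r -> 0 < k -> k <= 1 / 2 -> r <= p -> p <= C -> b0 <= c -> c <= b1 ->
  k * (r * C) <= b0 -> b1 <= (2 - k) * r ^+ 2 ->
  `|r * p - c| <= r * (1 - k / 2) * (p - r * (k / 2)).
Proof.
move=> r0 k0 k1 rp pC b0c cb1 kb0 kb1.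
have rpC : k * (r * p) <= k * (r * C).
  by rewrite !ler_pM2l.
have rrp : k * (r * r) <= k * (r * p).
  by rewrite !ler_pM2l.
have kk : 0 <= k * (k * (r * r)) by rewrite !mulr_ge0 ?ltW.
have dist : 0 <= (2 - k / 2) * (r * (p - r)).
  by apply: mulr_ge0; [lra | apply: mulr_ge0; lra].
set y := leRHS.
have yE : y = r * p - k * (r * p) / 2 - k * (r * r) / 2 + k * (k * (r * r)) / 4.
  by rewrite /y; field.
have distE : (2 - k / 2) * (r * (p - r)) =
    2 * (r * p) - 2 * (r * r) - k * (r * p) / 2 + k * (r * r) / 2 by field.
have rE : (2 - k) * r ^+ 2 = 2 * (r * r) - k * (r * r) by ring.
by apply/ler_normlP; split; lra.
Qed.

Lemma exponential_decay (a b : R -> R) (r b0 b1 T Ma Mb : R) :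
  0 < r -> 0 < b0 -> b1 < 2 * r ^+ 2 -> 0 <= T ->
  (forall t, T <= t -> [/\ 2 * r <= a t, b0 <= b t & b t <= b1]) ->
  {ae lebesgue_measure, forall t, t \in `[0, +oo[ -> `|a t| <= Ma} ->
  {ae lebesgue_measure, forall t, t \in `[0, +oo[ -> `|b t| <= Mb} ->
  exponentially_stable a b.
Proof.
move=> r0 b00 b1r T0 tail aM bM X fund.
set C := `|Ma| + 1; set L := `|Ma| + `|Mb| + 1.
have C0 : 0 < C by rewrite ltr_wpDl.
have L0 : 0 < L by rewrite ltr_wpDl // addr_ge0.
set k := Num.min (b0 / (r * C)) (Num.min (2 - b1 / r ^+ 2) (1 / 2)).
have r20 : 0 < r ^+ 2 by rewrite exprn_gt0.
have rC0 : 0 < r * C by rewrite mulr_gt0.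
have k0 : 0 < k.
  by rewrite !lt_min !divr_gt0 // subr_gt0 ltr_pdivrMr // b1r.
have kb0 : k * (r * C) <= b0.
  by rewrite -ler_pdivlMr // ge_min lexx.
have kb1 : b1 <= (2 - k) * r ^+ 2.
  by rewrite -ler_pdivrMr // lerBrDr addrC -lerBrDr !ge_min lexx orbT.
have k1 : k <= 1 / 2 by rewrite !ge_min lexx !orbT.
set m := r * (1 - k / 2); set l := r * (k / 2).
have m0 : 0 < m by rewrite mulr_gt0 //; lra.
have l0 : 0 < l by rewrite mulr_gt0 // divr_gt0.
set K0 := 1 + (1 + r) / m.
have K00 : 1 <= K0 by rewrite lerDl divr_ge0 // ltW // addr_gt0.
exists (K0 * expR (L * T) * expR (l * T)), l; split=> //.
  by rewrite !mulr_gt0 ?expR_gt0 // (lt_le_trans _ K00).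
move=> t s s0 st.
have [v [dx acv ode xs vs]] := fund s s0; set x := fun u => X u s in dx ode xs *.
rewrite -[X t s]/(x t).
have growth u : s <= u -> weighted_norm 0 1 x v u <= expR (L * (u - s)).
  move=> su.
  have W1 : weighted_norm 0 1 x v s = 1.
    rewrite /weighted_norm [x s]xs vs mulr0 addr0 divr1 normr0 normr1.
    by apply/max_idPr.
  have le : expR (- L * u) * weighted_norm 0 1 x v u <=
      expR (- L * s) * weighted_norm 0 1 x v s.
    apply: (@weighted_norm_nonincreasing _ a b s s u x v 0 1 (- L)) => //.
    - exact: acv.
    - by have := addr_ge0 (normr_ge0 Ma) (normr_ge0 Mb); rewrite /L; lra.
    - move: aM bM; apply: filterS2 => z az bz zsu.
      have z0 : z \in `[0, +oo[ by rewrite in_itv /= andbT; lra.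
      have {az} := az z0; have {bz} := bz z0.
      rewrite !mul0r sub0r normrN mul1r subr0 opprK /L.
      have := ler_norm (- a z); rewrite normrN.
      have := ler_norm Ma; have := ler_norm Mb; lra.
  rewrite W1 mulr1 in le.
  rewrite -(ler_pM2l (expR_gt0 (- L * u))) (le_trans le) // -expRD.
  by rewrite ler_expR; lra.
have x1 u : `|x u| <= weighted_norm 0 1 x v u.
  by rewrite le_max lexx.
have v1 u : `|v u| <= weighted_norm 0 1 x v u.
  by rewrite le_max mul0r addr0 divr1 lexx orbT.
have early u : s <= u -> u - s <= T ->
    weighted_norm 0 1 x v u <= expR (L * T).
  by move=> su uT; rewrite (le_trans (growth u su)) // ler_expR ler_pM2l.
have [tT|Tt] := leP (t - s) T.
  rewrite (le_trans (x1 t)) // (le_trans (early t st tT)) //.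
  rewrite -mulrA -mulrA -expRD -[leLHS]mul1r ler_pM ?expR_ge0 //.
  rewrite ler_peMr ?expR_ge0 // -[leLHS]expR0 ler_expR.
  by rewrite mulNr -mulrBr mulr_ge0 ?subr_ge0 // ltW.
set tau := s + T.
have stau : s <= tau by rewrite lerDl.
have taut : tau <= t by rewrite /tau; lra.
have Wtau : weighted_norm r m x v tau <= K0 * expR (L * T).
  have Ntau : weighted_norm 0 1 x v tau <= expR (L * T).
    by apply: early => //; rewrite /tau; lra.
  have := x1 tau; have := v1 tau; rewrite /weighted_norm ge_max.
  set n0 := Num.max _ _ in Ntau *; have E0 := expR_ge0 (L * T) => vn xn.
  apply/andP; split; first by rewrite (le_trans xn) // (le_trans Ntau) // ler_peMl.
  rewrite /K0 mulrDl mul1r -[leLHS]add0r lerD // mulrAC ler_pM2r ?invr_gt0 //.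
  rewrite (le_trans (ler_normD _ _)) // normrM (gtr0_norm r0) mulrDl mul1r.
  by rewrite lerD ?ler_pM2l // (le_trans _ Ntau).
have decay : expR (l * t) * weighted_norm r m x v t <=
    expR (l * tau) * weighted_norm r m x v tau.
  apply: (@weighted_norm_nonincreasing _ a b s tau t x v r m l) => //.
  - exact: abs_continuous_on_sub (acv t st).
  - by rewrite /l /m; lra.
  - move: aM; apply: filterS => z az ztau.
    have Tz : T <= z by move: ztau; rewrite /tau; lra.
    have z0 : z \in `[0, +oo[ by rewrite in_itv /= andbT; lra.
    have [az2 bz0 bz1] := tail z Tz.
    apply: (@damping_condition r (a z - r) (b z) b0 b1 C k) => //; first lra.
    have := az z0; have := ler_norm (a z); have := ler_norm Ma.
    rewrite /C; lra.
have xW : `|x t| <= weighted_norm r m x v t by rewrite le_max lexx.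
rewrite (le_trans xW) // -(ler_pM2l (expR_gt0 (l * t))) (le_trans decay) //.
have -> : expR (l * t) * (K0 * expR (L * T) * expR (l * T) *
    expR (- l * (t - s))) = expR (l * tau) * (K0 * expR (L * T)).
  have -> : l * tau = l * t + l * T + - l * (t - s) by rewrite /tau; ring.
  by rewrite !expRD; ring.
by rewrite ler_pM2l ?expR_gt0.
Qed.

End decay.

Theorem theorem7 (R : realType) (a b f : R -> R) (alpha beta B : \bar R)
  (a_meas : Lebesgue_measurable_fun `[0, +oo[ a)
  (a_bnd : ess_bounded_on `[0, +oo[ a)
  (b_meas : Lebesgue_measurable_fun `[0, +oo[ b)
  (b_bnd : ess_bounded_on `[0, +oo[ b)
  (f_meas : Lebesgue_measurable_fun `[0, +oo[ f)
  (f_bnd : locally_ess_bounded f)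
  (alphaE : alpha = liminf_pinfty a)
  (betaE : beta = liminf_pinfty b)
  (BE : B = limsup_pinfty b)
  (alpha_gt0 : (0 < alpha)%E)
  (beta_gt0 : (0 < beta)%E)
  (beta_le_B : (beta <= B)%E)
  (B_lt : (B < (2^-1)%:E * alpha ^+ 2)%E) :
  exponentially_stable a b.
Proof.
have [r [b0 [b1 [r0 b00 b1r ralpha [b0beta Bb1]]]]] :=
  strict_bounds alpha_gt0 beta_gt0 beta_le_B B_lt.
rewrite alphaE in ralpha; rewrite betaE in b0beta; rewrite BE in Bb1.
have [M1 aM1] := liminf_pinfty_gt ralpha.
have [M2 bM2] := liminf_pinfty_gt b0beta.
have [M3 bM3] := limsup_pinfty_lt Bb1.
have [Ma aM] := a_bnd; have [Mb bM] := b_bnd.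
pose T := `|M1| + `|M2| + `|M3| + 1.
apply: (@exponential_decay _ a b r b0 b1 T Ma Mb) => //.
  by rewrite !addr_ge0.
have := ler_norm M1; have := ler_norm M2; have := ler_norm M3.
have : 0 <= `|M1| by []. have : 0 <= `|M2| by []. have : 0 <= `|M3| by [].
rewrite /T => ? ? ? ? ? ? t Tt.
by split; [apply: aM1 | apply: bM2 | apply: bM3]; lra.
Qed.
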